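(* Let $\varphi$ be any formula of classical separation logic and let $(s,h)$ be any state. Then (1) $\underline{\varphi}(s,h)\in\{0,1\}$, and (2) $(s,h)\models\varphi$ if and only if $\underline{\varphi}(s,h)=1$, where $\underline{\varphi}\in\mathbb{E}_{\le 1}$ denotes the embedding of $\varphi$ into quantitative separation logic defined in the context.
   Context: A stack is a map $s:\mathrm{Vars}\to\mathbb{Z}$; a heap is a map $h:N\to\mathbb{Z}$ with $N\subseteq\mathbb{N}_{>0}$ finite, and $\mathrm{dom}(h)=N$. A state is a pair $(s,h)$; $\Sigma$ is the set of states. Heaps $h_1,h_2$ are disjoint ($h_1\perp h_2$) if $\mathrm{dom}(h_1)\cap\mathrm{dom}(h_2)=\emptyset$, and then $h_1\star h_2$ denotes their union. For an arithmetic expression $e$ over variables, $s(e)$ is its value; $s[x\mapsto v]$ is the stack updated at $x$. $\mathbb{E}_{\le 1}$ is the set of functions $\Sigma\to[0,1]$ ordered pointwise. For a predicate $\varphi$ on states, $[\varphi]$ is its indicator function. Classical separation logic (SL) formulas are built from atomic formulas (e.g. $\mathsf{emp}$, $e\mapsto e'$, $e\mapsto -$, and pure comparisons of expressions) using $\neg$, $\wedge$, $\exists x$, separating conjunction $\star$ and separating implication $\mathbin{-\!\!\star}$, with the standard semantics; in particular $(s,h)\models\varphi\star\psi$ iff there are $h_1\perp h_2$ with $h=h_1\star h_2$, $(s,h_1)\models\varphi$, $(s,h_2)\models\psi$; and $(s,h)\models\varphi\mathbin{-\!\!\star}\psi$ iff for all $h'\perp h$ with $(s,h')\models\varphi$ we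 have $(s,h\star h')\models\psi$. Quantitative connectives on $\mathbb{E}_{\le1}$: $(X\star Y)(s,h)=\max\{X(s,h_1)\cdot Y(s,h_2)\mid h=h_1\star h_2\}$, and $(Y\mathbin{-\!\!\star}X)(s,h)=\inf\{X(s,h\star h')/Y(s,h')\mid h'\perp h,\ Y(s,h')>0\}$, where the infimum is taken in the lattice $[0,1]$ (so $\inf\emptyset=1$). The embedding $\underline{\cdot}$ is defined inductively: $\underline{\varphi}=[\varphi]$ for atomic $\varphi$; $\underline{\neg\varphi}=1-\underline{\varphi}$; $\underline{\varphi_1\star\varphi_2}=\underline{\varphi_1}\star\underline{\varphi_2}$; $\underline{\varphi_1\mathbin{-\!\!\star}\varphi_2}=\underline{\varphi_1}\mathbin{-\!\!\star}\underline{\varphi_2}$; $\underline{\exists x\colon\varphi}=\sup_{v\in\mathbb{Z}}\underline{\varphi}[x/v]$ where $Z[x/v](s,h)=Z(s[x\mapsto v],h)$; $\underline{\varphi_1\wedge\varphi_2}=\underline{\varphi_1}\cdot\underline{\varphi_2}$ (pointwise product). *)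

(* Defs.v *)
From HB Require Import structures.
From mathcomp Require Import all_boot all_order all_algebra.
From mathcomp Require Import finmap.
From mathcomp Require Import boolp classical_sets reals interval_inference.

Set Implicit Arguments.
Unset Strict Implicit.
Unset Printing Implicit Defensive.

Import Order.TTheory GRing.Theory Num.Theory.

Local Open Scope classical_set_scope.
Local Open Scope ring_scope.

Definition stack (Vars : eqType) := Vars -> int.

Definition upd (Vars : eqType) (s : stack Vars) (x : Vars) (v : int) :
  stack Vars := fun y => if y == x then v else s y.

Definition loc := {n : nat | (0 < n)%N}.

Definition heap := {fmap loc -> int}.

Definition hdisj (h1 h2 : heap) : Prop := [disjoint domf h1 & domf h2]%fset.

(* [catf] is right-biased; it is only used under [hdisj], where it is the
   union. *)
Definition hstar (h1 h2 : heap) : heap := catf h1 h2.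

Definition state (Vars : eqType) := (stack Vars * heap)%type.

Inductive expr (Vars : eqType) : Type :=
| ECst of int
| EVar of Vars
| EAdd of expr Vars & expr Vars
| ESub of expr Vars & expr Vars
| EMul of expr Vars & expr Vars.

Fixpoint eval (Vars : eqType) (s : stack Vars) (e : expr Vars) : int :=
  match e with
  | ECst n => n
  | EVar x => s x
  | EAdd e1 e2 => eval s e1 + eval s e2
  | ESub e1 e2 => eval s e1 - eval s e2
  | EMul e1 e2 => eval s e1 * eval s e2
  end.

(* The collection of atomic formulas is left open-ended: besides the usual
   ones, [AOther] provides arbitrary further atoms, with names in [A] and a
   meaning given by an interpretation [A -> state Vars -> Prop]. *)
Inductive atom (Vars : eqType) (A : Type) : Type :=
| AEmp
| APointsTo of expr Vars & expr Vars
| APointsToAny of expr Vars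
| AEq of expr Vars & expr Vars
| ALe of expr Vars & expr Vars
| ALt of expr Vars & expr Vars
| AOther of A.

Arguments AEmp {Vars A}.

Inductive formula (Vars : eqType) (A : Type) : Type :=
| FAtom of atom Vars A
| FNot of formula Vars A
| FAnd of formula Vars A & formula Vars A
| FEx of Vars & formula Vars A
| FSep of formula Vars A & formula Vars A
| FWand of formula Vars A & formula Vars A.

(* Points-to assertions are exact: the heap consists of a single cell. *)
Definition atom_sat (Vars : eqType) (A : Type)
    (I : A -> state Vars -> Prop) (a : atom Vars A) (sh : state Vars) : Prop :=
  let: (s, h) := sh in
  match a with
  | AEmp => domf h = fset0
  | APointsTo e e' => exists l : loc,
      [/\ (val l)%:Z = eval s e, domf h = [fset l]%fset
        & h.[? l]%fmap = Some (eval s e')]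
  | APointsToAny e => exists l : loc,
      (val l)%:Z = eval s e /\ domf h = [fset l]%fset
  | AEq e e' => eval s e = eval s e'
  | ALe e e' => eval s e <= eval s e'
  | ALt e e' => eval s e < eval s e'
  | AOther b => I b (s, h)
  end.

Fixpoint sat (Vars : eqType) (A : Type) (I : A -> state Vars -> Prop)
    (s : stack Vars) (h : heap) (phi : formula Vars A) {struct phi} : Prop :=
  match phi with
  | FAtom a => atom_sat I a (s, h)
  | FNot p => ~ sat I s h p
  | FAnd p q => sat I s h p /\ sat I s h q
  | FEx x p => exists v : int, sat I (upd s x v) h p
  | FSep p q => exists h1 h2 : heap,
      [/\ hdisj h1 h2, h = hstar h1 h2, sat I s h1 p & sat I s h2 q]
  | FWand p q => forall h' : heap,
      hdisj h h' -> sat I s h' p -> sat I s (hstar h h') q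
  end.

(* One-bounded expectations, i.e. functions from states to [0, 1]. *)
Definition expectation (R : realType) (Vars : eqType) :=
  state Vars -> {i01 R}.

Section connectives.
Context {R : realType} {Vars : eqType}.
Implicit Types (X Y : expectation R Vars) (sh : state Vars).

Lemma sup_i01 (S : set R) :
  (forall r, S r -> 0 <= r <= 1) -> 0 <= sup S <= 1.
Proof.
move=> S01; have [->|/set0P[r Sr]] := eqVneq S set0; first by rewrite sup0 lexx ler01.
have [r0 r1] := andP (S01 r Sr).
have ubS : ubound S 1 by move=> x /S01/andP[].
apply/andP; split; first by apply: (le_trans r0); apply: ub_le_sup => //; exists 1.
by apply: ge_sup => //; exists r.
Qed.

Definition sup01 (S : set R) (S01 : forall r, S r -> 0 <= r <= 1) : {i01 R} :=
  Itv01 (proj1 (andP (sup_i01 S01))) (proj2 (andP (sup_i01 S01))).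

Lemma inf_i01 (S : set R) :
  (forall r, S r -> 0 <= r) -> 0 <= inf (1 |` S) <= 1.
Proof.
move=> S0; have lb0 : lbound (1 |` S) 0.
  by move=> x [->|/S0//]; exact: ler01.
apply/andP; split; first by apply: lb_le_inf => //; exists 1; left.
by apply: ge_inf; [exists 0 | left].
Qed.

(* Greatest lower bound of [S] in the lattice [0, 1], see [inf01_glb]; it is 1
   when [S] is empty. *)
Definition inf01 (S : set R) (S0 : forall r, S r -> 0 <= r) : {i01 R} :=
  Itv01 (proj1 (andP (inf_i01 S0))) (proj2 (andP (inf_i01 S0))).

Definition iverson (P : state Vars -> Prop) : expectation R Vars :=
  fun sh => if `[< P sh >] then 1%:i01 else 0%:i01.

Definition qnot X : expectation R Vars := fun sh => (1 - (X sh)%:num)%:i01.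

Definition qmul X Y : expectation R Vars :=
  fun sh => ((X sh)%:num * (Y sh)%:num)%:i01.

Definition qsubst X (x : Vars) (v : int) : expectation R Vars :=
  fun sh => X (upd sh.1 x v, sh.2).

Definition qex_vals X (x : Vars) sh : set R :=
  [set (qsubst X x v sh)%:num | v in [set: int]].

Lemma qex_vals01 X x sh r : qex_vals X x sh r -> 0 <= r <= 1.
Proof. by move=> [v _ <-]; apply/andP. Qed.

Definition qex (x : Vars) X : expectation R Vars :=
  fun sh => sup01 (@qex_vals01 X x sh).

Definition qsep_vals X Y sh : set R :=
  [set r | exists h1 h2 : heap,
    [/\ hdisj h1 h2, sh.2 = hstar h1 h2
      & r = (X (sh.1, h1))%:num * (Y (sh.1, h2))%:num]].

Lemma qsep_vals01 X Y sh r : qsep_vals X Y sh r -> 0 <= r <= 1.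
Proof.
by move=> [h1 [h2 [_ _ ->]]]; apply/andP; split; rewrite ?mulr_ge0 ?mulr_ile1.
Qed.

(* The supremum is a maximum, see [qsep_max]. *)
Definition qsep X Y : expectation R Vars :=
  fun sh => sup01 (@qsep_vals01 X Y sh).

Definition qwand_vals Y X sh : set R :=
  [set r | exists h' : heap,
    [/\ hdisj sh.2 h', 0 < (Y (sh.1, h'))%:num
      & r = (X (sh.1, hstar sh.2 h'))%:num / (Y (sh.1, h'))%:num]].

Lemma qwand_vals_ge0 Y X sh r : qwand_vals Y X sh r -> 0 <= r.
Proof. by move=> [h' [_ _ ->]]; rewrite divr_ge0. Qed.

Definition qwand Y X : expectation R Vars :=
  fun sh => inf01 (@qwand_vals_ge0 Y X sh).

Lemma qsep_max X Y sh : qsep_vals X Y sh (qsep X Y sh)%:num.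
Proof.
case: sh => s h; pose T : finType := fpowerset (domf h).
pose F (B : T) : R :=
  (X (s, h.[& val B]%fmap))%:num * (Y (s, h.[\ val B]%fmap))%:num.
have B0P : fset0 \in fpowerset (domf h) by rewrite fpowersetE fsub0set.
case: (@arg_maxP _ _ T [` B0P]%fset xpredT F isT) => B _ Bmax.
have FB : qsep_vals X Y (s, h) (F B).
  exists (h.[& val B])%fmap, (h.[\ val B])%fmap; split => //=.
    apply/fdisjointP => l; rewrite !domf_restrict !inE.
    by case: (l \in val B); rewrite /= ?andbF.
  apply/fmapP => l; rewrite fnd_cat fnd_rem domf_restrict fnd_restrict !inE.
  by case: (l \in val B) => //=; case: fndP.
have ubF : ubound (qsep_vals X Y (s, h)) (F B).
  move=> r [h1 [h2 [/= dh12 hE ->]]].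
  have CP : domf h1 \in fpowerset (domf h).
    by rewrite fpowersetE hE domf_cat fsubsetUl.
  have := Bmax [` CP]%fset isT; rewrite /F /=.
  have -> : (h.[& domf h1])%fmap = h1.
    by rewrite hE /hstar disjoint_catfC// restrictf_cat_domr.
  have -> // : (h.[\ domf h1])%fmap = h2.
  apply/fmapP => l; rewrite fnd_rem hE fnd_cat.
  have [l1|l1] := boolP (l \in domf h1).
    by rewrite not_fnd//; exact: (fdisjointP dh12).
  by case: ifPn => // l2; rewrite !not_fnd.
suff -> : (qsep X Y (s, h))%:num = F B by [].
apply/eqP; rewrite eq_le; apply/andP; split.
  by apply: ge_sup => //; exists (F B).
by apply: ub_le_sup => //; exists (F B).
Qed.

Lemma inf01_glb (S : set R) (S0 : forall r, S r -> 0 <= r) (x : {i01 R}) :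
  x%:num <= (inf01 S0)%:num <-> lbound S x%:num.
Proof.
split => [xS r Sr|xS].
  apply: (le_trans xS); apply: ge_inf; last by right.
  by exists 0 => y [->|/S0//]; exact: ler01.
by apply: lb_le_inf; [exists 1; left | move=> r [->|/xS]].
Qed.

End connectives.

Fixpoint embed (R : realType) (Vars : eqType) (A : Type)
    (I : A -> state Vars -> Prop) (phi : formula Vars A) :
    expectation R Vars :=
  match phi with
  | FAtom a => iverson (atom_sat I a)
  | FNot p => qnot (embed R I p)
  | FAnd p q => qmul (embed R I p) (embed R I q)
  | FEx x p => qex x (embed R I p)
  | FSep p q => qsep (embed R I p) (embed R I q)
  | FWand p q => qwand (embed R I p) (embed R I q)
  end.

(* Main.v *)
Require Import Defs.
From mathcomp Require Import all_boot all_order all_algebra.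
From mathcomp Require Import finmap.
From mathcomp Require Import boolp classical_sets reals interval_inference.
Import Order.TTheory GRing.Theory Num.Theory.
Local Open Scope classical_set_scope.
Local Open Scope ring_scope.

(** By structural induction, [embed R I phi] is the indicator of [sat I phi].
    Every connective is then evaluated on indicators only, so the suprema and
    infima range over subsets of {0, 1}, where a supremum is 1 exactly when 1 is
    a member and an infimum in [0, 1] is 0 exactly when 0 is a member. *)

(** If 1 belongs to [S], it is the maximum; otherwise [S], being nonempty, is {0}. *)
Lemma sup_boolean {R : realType} (S : set R) :
  S !=set0 -> (forall r, S r -> r = 0 \/ r = 1) -> sup S = `[< S 1 >]%:R.
Proof.
move=> S0 S01; case: (asboolP (S 1)) => S1.
  apply/eqP; rewrite eq_le; apply/andP; split.
    by apply: ge_sup => // r /S01[]->.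
  by apply: ub_le_sup => //; exists 1 => r /S01[]->.
have -> : S = [set 0]; last by rewrite sup1.
have S_eq0 r : S r -> r = 0.
  by move=> Sr; have [//|r1] := S01 r Sr; rewrite r1 in Sr.
case: S0 => r0 Sr0; apply/seteqP; split => [r /S_eq0//|r ->].
by rewrite -(S_eq0 r0 Sr0).
Qed.

(** Adjoining 1 gives the infimum in [0, 1], as in [inf01]. If 0 is in [S], it is the minimum;
    otherwise the enlarged set is {1}. *)
Lemma inf_boolean {R : realType} (S : set R) :
  (forall r, S r -> r = 0 \/ r = 1) -> inf (1 |` S) = (~~ `[< S 0 >])%:R.
Proof.
move=> S01; have lb0 : lbound (1 |` S) 0 by move=> r [->|/S01[]->].
case: (asboolP (S 0)) => S0 /=.
  apply/eqP; rewrite eq_le; apply/andP; split.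
    by apply: ge_inf; [exists 0 | right].
  by apply: lb_le_inf => //; exists 1; left.
have -> : 1 |` S = [set 1]; last by rewrite inf1.
apply/seteqP; split => [r [->//|Sr]|r ->]; last by left.
by have [r0|//] := S01 r Sr; rewrite r0 in Sr.
Qed.

Lemma natr_bool_eq1 {R : realType} (b : bool) : (b%:R = 1 :> R) <-> b.
Proof.
by case: b; split => // /eqP; rewrite eq_sym oner_eq0.
Qed.

Lemma embed_indicator (R : realType) (Vars : eqType) (A : Type)
    (I : A -> state Vars -> Prop) (phi : formula Vars A)
    (s : stack Vars) (h : heap) :
  (embed R I phi (s, h))%:num = `[< sat I s h phi >]%:R.
Proof.
(* The state is generalized: the quantifier updates the stack, and the separating connectives change
   the heap. *)
elim: phi s h => [a|p IHp|p IHp q IHq|x p IHp|p IHp q IHq|p IHp q IHq] s h /=.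
- by rewrite /iverson; case: asboolP.
- by rewrite IHp asbool_neg; case: asboolP; rewrite /= ?subrr ?subr0.
- by rewrite IHp IHq asbool_and -natrM mulnb.
- rewrite sup_boolean; first last.
  + by move=> _ [v _ <-]; rewrite /qsubst IHp; case: asboolP; [right|left].
  + by eexists; exists 0.
  congr (nat_of_bool _)%:R; apply: asbool_equiv_eq; split.
    by move=> [v _]; rewrite /qsubst IHp => /natr_bool_eq1/asboolP; exists v.
  by move=> [v pv]; exists v => //; rewrite /qsubst IHp asboolT.
- rewrite sup_boolean; first last.
  + move=> _ [h1 [h2 [_ _ ->]]]; rewrite IHp IHq -natrM mulnb.
    by case: (_ && _); [right|left].
  (* The supremum is attained, so it is itself a member. *)
  + by eexists; exact: qsep_max.
  congr (nat_of_bool _)%:R; apply: asbool_equiv_eq; split.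
    move=> [h1 [h2 [/= dh hE]]]; rewrite IHp IHq -natrM mulnb.
    by move=> /esym/natr_bool_eq1/andP[/asboolP ? /asboolP ?]; exists h1, h2.
  move=> [h1 [h2 [dh hE p1 q2]]]; exists h1, h2; split => //=.
  by rewrite IHp IHq !asboolT// mulr1.
(* A positive indicator equals 1, so each admissible quotient divides by 1 and is the indicator of
   [q] on the extended heap. *)
- have val h' : 0 < (embed R I p (s, h'))%:num ->
      sat I s h' p /\ (embed R I q (s, hstar h h'))%:num /
        (embed R I p (s, h'))%:num = `[< sat I s (hstar h h') q >]%:R.
    by rewrite IHp IHq; case: asboolP => //; rewrite ?ltxx// divr1.
  rewrite inf_boolean; last first.
    by move=> _ [h' [_ /val[_ /= -> ->]]]; case: asboolP; [right|left].
  (* A quotient equal to 0 is exactly a counterexample to the wand: a disjoint [h'] satisfying [p]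
     whose union with [h] violates [q]. *)
  rewrite -asbool_neg; congr (nat_of_bool _)%:R.
  apply: asbool_equiv_eq; split => [no0 h' dh ph'|wand [h' [/= dh /val[ph' ->]]]].
    apply: contrapT => nq; apply: no0; exists h'.
    by rewrite /= IHp IHq asboolT// asboolF// mul0r.
  by rewrite asboolT; [move/esym/eqP; rewrite oner_eq0 | exact: wand].
Qed.

Theorem theorem3p4 (R : realType) (Vars : eqType) (A : Type)
    (I : A -> state Vars -> Prop) (phi : formula Vars A)
    (s : stack Vars) (h : heap) :
  ((embed R I phi (s, h))%:num = 0 \/ (embed R I phi (s, h))%:num = 1) /\
  (sat I s h phi <-> (embed R I phi (s, h))%:num = 1).
Proof.
rewrite embed_indicator; split; first by case: asboolP; [right|left].
by split => [/asboolT->//|/natr_bool_eq1/asboolP].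
Qed.
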